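(* Let $(\mathcal{T},\otimes,\Sigma,\mathbb{1})$ be a non-zero monoidal triangulated category and let $\mathbb{t}=(\mathcal{D}^{\leqslant 0},\mathcal{D}^{\geqslant 1})$ be a monoidal t-structure on $\mathcal{T}$ with $0\in\mathrm{dev}(\mathbb{t})$. Then the heart $\mathcal{H}_{\mathbb{t}}$ (with the tensor product inherited from $\mathcal{T}$) is a monoidal abelian category with a biexact tensor product, whose unit is $H^0_{\mathbb{t}}(\mathbb{1})$.
   Context: All categories are linear over an algebraically closed field $\mathbb{k}$. A monoidal triangulated category $(\mathcal{T},\otimes,\Sigma,\mathbb{1})$ is a triangulated category with shift $\Sigma$ that is also monoidal with unit $\mathbb{1}$ such that $\otimes$ is exact (triangulated) in each variable; this involves isomorphisms $\Sigma(X)\otimes Y\cong\Sigma(X\otimes Y)\cong X\otimes\Sigma(Y)$ natural in $X,Y$ (no further compatibility is required). A t-structure on $\mathcal{T}$ is a pair of full strict subcategories $\mathbb{t}=(\mathcal{D}^{\leqslant 0},\mathcal{D}^{\geqslant 1})$ with $\Sigma\mathcal{D}^{\leqslant 0}\subseteq\mathcal{D}^{\leqslant 0}$, $\mathcal{D}^{\geqslant 1}\subseteq\Sigma\mathcal{D}^{\geqslant 1}$, $\mathrm{Hom}_{\mathcal{T}}(\mathcal{D}^{\leqslant 0},\mathcal{D}^{\geqslant 1})=0$, and for each $X\in\mathcal{T}$ a distinguished triangle $X^{\leqslant 0}\to X\to X^{\geqslant 1}\to\Sigma X^{\leqslant 0}$ with $X^{\leqslant 0}\in\mathcal{D}^{\leqslant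 0}$, $X^{\geqslant 1}\in\mathcal{D}^{\geqslant 1}$. Put $\mathcal{D}^{\leqslant n}:=\Sigma^{-n}\mathcal{D}^{\leqslant 0}$, $\mathcal{D}^{\geqslant n+1}:=\Sigma^{-n}\mathcal{D}^{\geqslant 1}$. The heart is $\mathcal{H}_{\mathbb{t}}:=\mathcal{D}^{\leqslant 0}\cap\mathcal{D}^{\geqslant 0}$ (an abelian category), $\tau^{\leqslant n}_{\mathbb{t}},\tau^{\geqslant n}_{\mathbb{t}}$ are the truncation functors and $H^0_{\mathbb{t}}:=\tau^{\leqslant 0}_{\mathbb{t}}\tau^{\geqslant 0}_{\mathbb{t}}:\mathcal{T}\to\mathcal{H}_{\mathbb{t}}$. $\mathbb{t}$ is bounded if $\bigcup_n\mathcal{D}^{\leqslant n}=\mathcal{T}=\bigcup_n\mathcal{D}^{\geqslant n}$. A monoidal t-structure is a bounded t-structure for which there exists $n\in\mathbb{Z}$ with $\mathcal{D}^{\leqslant 0}\otimes\mathcal{D}^{\leqslant n}\subseteq\mathcal{D}^{\leqslant 0}$ and $\mathcal{D}^{\geqslant 0}\otimes\mathcal{D}^{\geqslant n}\subseteq\mathcal{D}^{\geqslant 0}$; the set of all such $n$ is the deviation $\mathrm{dev}(\mathbb{t})$. *)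

(* Defs.v *)
From mathcomp Require Import all_boot all_algebra.

Set Implicit Arguments.
Unset Strict Implicit.
Unset Printing Implicit Defensive.
Local Obligation Tactic := idtac.

Import GRing.Theory.
Local Open Scope ring_scope.

Declare Scope cat_scope.
Delimit Scope cat_scope with cat.

Record category (k : closedFieldType) := Category {
  obj :> Type;
  hom : obj -> obj -> lmodType k;
  idm : forall X, hom X X;
  comp : forall X Y Z, hom Y Z -> hom X Y -> hom X Z;
  compA : forall X Y Z W (h : hom Z W) (g : hom Y Z) (f : hom X Y),
    comp h (comp g f) = comp (comp h g) f;
  comp1m : forall X Y (f : hom X Y), comp (idm Y) f = f;
  compm1 : forall X Y (f : hom X Y), comp f (idm X) = f;
  comp_linearr : forall X Y Z (g : hom Y Z) (a : k) (f f' : hom X Y),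
    comp g (a *: f + f') = a *: comp g f + comp g f';
  comp_linearl : forall X Y Z (f : hom X Y) (a : k) (g g' : hom Y Z),
    comp (a *: g + g') f = a *: comp g f + comp g' f
}.

Arguments hom {k c} X Y.
Arguments idm {k c} X.
Arguments comp {k c X Y Z} g f.

Notation "g ∘ f" := (comp g f) (at level 40, left associativity) : cat_scope.
Local Open Scope cat_scope.

Record functor (k : closedFieldType) (C D : category k) := Functor {
  fobj :> C -> D;
  fmap : forall X Y, hom X Y -> hom (fobj X) (fobj Y);
  fmap_id : forall X, fmap (idm X) = idm (fobj X);
  fmap_comp : forall X Y Z (g : hom Y Z) (f : hom X Y),
    fmap (g ∘ f) = fmap g ∘ fmap f;
  fmap_linear : forall X Y (a : k) (f f' : hom X Y),
    fmap (a *: f + f') = a *: fmap f + fmap f'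
}.

Arguments fmap {k C D} F {X Y} f : rename.

Section Categories.
Variables (k : closedFieldType) (C : category k).
Implicit Types X Y Z W : C.

Definition is_iso X Y (f : hom X Y) : Prop :=
  exists g : hom Y X, g ∘ f = idm X /\ f ∘ g = idm Y.

Definition isomorphic X Y : Prop := exists f : hom X Y, is_iso f.

Definition mono X Y (f : hom X Y) : Prop :=
  forall W (g h : hom W X), f ∘ g = f ∘ h -> g = h.

Definition epi X Y (f : hom X Y) : Prop :=
  forall W (g h : hom Y W), g ∘ f = h ∘ f -> g = h.

(* Initial and terminal; the unique morphism is necessarily 0. *)
Definition is_zero Z : Prop :=
  (forall X (f : hom Z X), f = 0) /\ (forall X (f : hom X Z), f = 0).

Definition is_kernel X Y K (f : hom X Y) (i : hom K X) : Prop :=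
  f ∘ i = 0 /\
  forall W (h : hom W X), f ∘ h = 0 -> exists! u : hom W K, i ∘ u = h.

Definition is_cokernel X Y Q (f : hom X Y) (p : hom Y Q) : Prop :=
  p ∘ f = 0 /\
  forall W (h : hom Y W), h ∘ f = 0 -> exists! u : hom Q W, u ∘ p = h.

Definition is_biproduct X Y S
    (i1 : hom X S) (i2 : hom Y S) (p1 : hom S X) (p2 : hom S Y) : Prop :=
  [/\ p1 ∘ i1 = idm X, p2 ∘ i2 = idm Y, p1 ∘ i2 = 0, p2 ∘ i1 = 0
    & i1 ∘ p1 + i2 ∘ p2 = idm S].

Definition additive_category : Prop :=
  (exists Z, is_zero Z) /\
  (forall X Y, exists S i1 i2 p1 p2, @is_biproduct X Y S i1 i2 p1 p2).

Definition abelian_category : Prop :=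
  [/\ additive_category,
      forall X Y (f : hom X Y), exists K (i : hom K X), is_kernel f i,
      forall X Y (f : hom X Y), exists Q (p : hom Y Q), is_cokernel f p,
      forall X Y (f : hom X Y), mono f ->
        exists Z (g : hom Y Z), is_kernel g f
    & forall X Y (f : hom X Y), epi f ->
        exists W (g : hom W X), is_cokernel g f].

(* 0 -> X -> Y -> Z -> 0 *)
Definition short_exact X Y Z (f : hom X Y) (g : hom Y Z) : Prop :=
  is_kernel g f /\ is_cokernel f g.

Program Definition full_subcategory (P : C -> Prop) : category k :=
  @Category k {X : C | P X}
    (fun X Y : {X : C | P X} => hom (sval X) (sval Y))
    (fun X : {X : C | P X} => idm (sval X))
    (fun (X Y Z : {X : C | P X}) (g : hom (sval Y) (sval Z))
         (f : hom (sval X) (sval Y)) => g ∘ f)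
    _ _ _ _ _.
Next Obligation. by move=> *; apply: compA. Qed.
Next Obligation. by move=> *; apply: comp1m. Qed.
Next Obligation. by move=> *; apply: compm1. Qed.
Next Obligation. by move=> *; apply: comp_linearr. Qed.
Next Obligation. by move=> *; apply: comp_linearl. Qed.

End Categories.

Definition exact_functor (k : closedFieldType) (C D : category k)
    (F : functor C D) : Prop :=
  forall X Y Z (f : hom X Y) (g : hom Y Z),
    short_exact f g -> short_exact (fmap F f) (fmap F g).

(* A bilinear tensor product with its associativity constraint; the unit is
   kept apart since it is not inherited by the heart. *)
Record tensor_product (k : closedFieldType) (C : category k) := TensorProduct {
  tens : C -> C -> C;
  tensm : forall X X' Y Y',
    hom X X' -> hom Y Y' -> hom (tens X Y) (tens X' Y');
  tensm_id : forall X Y, tensm (idm X) (idm Y) = idm (tens X Y);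
  tensm_comp : forall X X' X'' Y Y' Y''
    (f' : hom X' X'') (f : hom X X') (g' : hom Y' Y'') (g : hom Y Y'),
    tensm (f' ∘ f) (g' ∘ g) = tensm f' g' ∘ tensm f g;
  tensm_linearl : forall X X' Y Y' (a : k) (f f' : hom X X') (g : hom Y Y'),
    tensm (a *: f + f') g = a *: tensm f g + tensm f' g;
  tensm_linearr : forall X X' Y Y' (f : hom X X') (a : k) (g g' : hom Y Y'),
    tensm f (a *: g + g') = a *: tensm f g + tensm f g';
  assoc : forall X Y Z, hom (tens (tens X Y) Z) (tens X (tens Y Z));
  assoc_iso : forall X Y Z, is_iso (assoc X Y Z);
  assoc_natural : forall X X' Y Y' Z Z'
    (f : hom X X') (g : hom Y Y') (h : hom Z Z'),
    assoc X' Y' Z' ∘ tensm (tensm f g) h =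
    tensm f (tensm g h) ∘ assoc X Y Z;
  pentagon : forall X Y Z W,
    assoc X Y (tens Z W) ∘ assoc (tens X Y) Z W =
    tensm (idm X) (assoc Y Z W) ∘ assoc X (tens Y Z) W
      ∘ tensm (assoc X Y Z) (idm W)
}.

Arguments tens {k C} t X Y.
Arguments tensm {k C} t {X X' Y Y'} f g.
Arguments assoc {k C} t X Y Z.

Record monoidal (k : closedFieldType) (C : category k) := Monoidal {
  tensor :> tensor_product C;
  tunit : C;
  lunit : forall X, hom (tens tensor tunit X) X;
  runit : forall X, hom (tens tensor X tunit) X;
  lunit_iso : forall X, is_iso (lunit X);
  runit_iso : forall X, is_iso (runit X);
  lunit_natural : forall X Y (f : hom X Y),
    lunit Y ∘ tensm tensor (idm tunit) f = f ∘ lunit X;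
  runit_natural : forall X Y (f : hom X Y),
    runit Y ∘ tensm tensor f (idm tunit) = f ∘ runit X;
  unit_triangle : forall X Y,
    tensm tensor (idm X) (lunit Y) ∘ assoc tensor X tunit Y =
    tensm tensor (runit X) (idm Y)
}.

Section TensorFunctors.
Variables (k : closedFieldType) (C : category k) (t : tensor_product C).

Program Definition tensor_left (X : C) : functor C C :=
  @Functor k C C (tens t X) (fun Y Y' g => tensm t (idm X) g) _ _ _.
Next Obligation. by move=> X Y; apply: tensm_id. Qed.
Next Obligation. by move=> X Y Z W g f; rewrite -tensm_comp comp1m. Qed.
Next Obligation. by move=> X Y Y' a f f'; apply: tensm_linearr. Qed.

Program Definition tensor_right (Y : C) : functor C C :=
  @Functor k C C (fun X => tens t X Y) (fun X X' f => tensm t f (idm Y)) _ _ _.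
Next Obligation. by move=> Y X; apply: tensm_id. Qed.
Next Obligation. by move=> Y X Z W g f; rewrite -tensm_comp comp1m. Qed.
Next Obligation. by move=> Y X X' a f f'; apply: tensm_linearl. Qed.

Definition biexact : Prop :=
  forall X, exact_functor (tensor_left X) /\ exact_functor (tensor_right X).

Definition tensor_closed (P : C -> Prop) : Prop :=
  forall X Y, P X -> P Y -> P (tens t X Y).

Program Definition restrict_tensor (P : C -> Prop) (HP : tensor_closed P) :
    tensor_product (full_subcategory P) :=
  @TensorProduct k (full_subcategory P)
    (fun X Y => exist P (tens t (sval X) (sval Y)) (HP _ _ (svalP X) (svalP Y)))
    (fun X X' Y Y' f g => tensm t f g)
    _ _ _ _
    (fun X Y Z => assoc t (sval X) (sval Y) (sval Z))
    _ _ _.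
Next Obligation. by move=> *; apply: tensm_id. Qed.
Next Obligation. by move=> *; apply: tensm_comp. Qed.
Next Obligation. by move=> *; apply: tensm_linearl. Qed.
Next Obligation. by move=> *; apply: tensm_linearr. Qed.
Next Obligation. by move=> P HP X Y Z; apply: (assoc_iso t). Qed.
Next Obligation. by move=> *; apply: assoc_natural. Qed.
Next Obligation. by move=> *; apply: pentagon. Qed.

End TensorFunctors.

Record triangulated (k : closedFieldType) := Triangulated {
  tcat :> category k;
  tcat_additive : additive_category tcat;
  (* The shift is an autoequivalence; [unshift] is a chosen quasi-inverse. *)
  shift : functor tcat tcat;
  unshift : functor tcat tcat;
  shiftK : forall X, hom X (unshift (shift X));
  unshiftK : forall X, hom (shift (unshift X)) X;
  shiftK_iso : forall X, is_iso (shiftK X);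
  unshiftK_iso : forall X, is_iso (unshiftK X);
  shiftK_natural : forall X Y (f : hom X Y),
    shiftK Y ∘ f = fmap unshift (fmap shift f) ∘ shiftK X;
  unshiftK_natural : forall X Y (f : hom X Y),
    unshiftK Y ∘ fmap shift (fmap unshift f) = f ∘ unshiftK X;
  (* X -> Y -> Z -> ΣX *)
  distinguished : forall X Y Z : tcat,
    hom X Y -> hom Y Z -> hom Z (shift X) -> Prop;
  distinguished_iso : forall X Y Z X' Y' Z'
    (f : hom X Y) (g : hom Y Z) (h : hom Z (shift X))
    (f' : hom X' Y') (g' : hom Y' Z') (h' : hom Z' (shift X'))
    (a : hom X X') (b : hom Y Y') (c : hom Z Z'),
    is_iso a -> is_iso b -> is_iso c ->
    b ∘ f = f' ∘ a -> c ∘ g = g' ∘ b -> fmap shift a ∘ h = h' ∘ c ->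
    distinguished f g h -> distinguished f' g' h';
  distinguished_id : forall X Z, is_zero Z ->
    distinguished (idm X) (0 : hom X Z) (0 : hom Z (shift X));
  distinguished_cone : forall X Y (f : hom X Y),
    exists Z (g : hom Y Z) (h : hom Z (shift X)), distinguished f g h;
  distinguished_rotate : forall X Y Z
    (f : hom X Y) (g : hom Y Z) (h : hom Z (shift X)),
    distinguished f g h <-> distinguished g h (- fmap shift f);
  distinguished_morphism : forall X Y Z X' Y' Z'
    (f : hom X Y) (g : hom Y Z) (h : hom Z (shift X))
    (f' : hom X' Y') (g' : hom Y' Z') (h' : hom Z' (shift X'))
    (a : hom X X') (b : hom Y Y'),
    distinguished f g h -> distinguished f' g' h' -> b ∘ f = f' ∘ a ->
    exists c : hom Z Z', c ∘ g = g' ∘ b /\ fmap shift a ∘ h = h' ∘ c;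
  octahedral : forall X Y Z X' Y' Z'
    (f : hom X Y) (u : hom Y Z') (u' : hom Z' (shift X))
    (g : hom Y Z) (v : hom Z X') (v' : hom X' (shift Y))
    (w : hom Z Y') (w' : hom Y' (shift X)),
    distinguished f u u' -> distinguished g v v' ->
    distinguished (g ∘ f) w w' ->
    exists (a : hom Z' Y') (b : hom Y' X'),
      [/\ distinguished a b (fmap shift u ∘ v'),
          a ∘ u = w ∘ g, w' ∘ a = u', b ∘ w = v
        & v' ∘ b = fmap shift f ∘ w']
}.

Arguments shift {k t}.
Arguments unshift {k t}.
Arguments distinguished {k t X Y Z} f g h.

(* [shiftn n X] is Σ^n X. *)
Definition shiftn (k : closedFieldType) (T : triangulated k)
    (n : int) (X : T) : T :=
  match n with
  | Posz m => iter m shift X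
  | Negz m => iter m.+1 unshift X
  end.

Definition triangulated_functor (k : closedFieldType) (T T' : triangulated k)
    (F : functor T T') (phi : forall X, hom (F (shift X)) (shift (F X))) : Prop :=
  forall X Y Z (f : hom X Y) (g : hom Y Z) (h : hom Z (shift X)),
    distinguished f g h ->
    distinguished (fmap F f) (fmap F g) (phi X ∘ fmap F h).

Record monoidal_triangulated (k : closedFieldType) := MonoidalTriangulated {
  mtcat :> triangulated k;
  mt_monoidal : monoidal mtcat;
  shift_tensl : forall X Y,
    hom (tens mt_monoidal (shift X) Y) (shift (tens mt_monoidal X Y));
  shift_tensr : forall X Y,
    hom (tens mt_monoidal X (shift Y)) (shift (tens mt_monoidal X Y));
  shift_tensl_iso : forall X Y, is_iso (shift_tensl X Y);
  shift_tensr_iso : forall X Y, is_iso (shift_tensr X Y);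
  shift_tensl_natural : forall X X' Y Y' (f : hom X X') (g : hom Y Y'),
    shift_tensl X' Y' ∘ tensm mt_monoidal (fmap shift f) g =
    fmap shift (tensm mt_monoidal f g) ∘ shift_tensl X Y;
  shift_tensr_natural : forall X X' Y Y' (f : hom X X') (g : hom Y Y'),
    shift_tensr X' Y' ∘ tensm mt_monoidal f (fmap shift g) =
    fmap shift (tensm mt_monoidal f g) ∘ shift_tensr X Y;
  tensor_left_triangulated : forall X,
    @triangulated_functor k mtcat mtcat
      (tensor_left mt_monoidal X) (shift_tensr X);
  tensor_right_triangulated : forall Y,
    @triangulated_functor k mtcat mtcat
      (tensor_right mt_monoidal Y) (shift_tensl^~ Y)
}.

(* The truncation triangles X^{<=0} -> X -> X^{>=1} -> ΣX^{<=0} are part of the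
   data; they are determined by the two subcategories up to unique
   isomorphism. *)
Record t_structure (k : closedFieldType) (T : triangulated k) := TStructure {
  le0 : T -> Prop;
  ge1 : T -> Prop;
  le0_strict : forall X Y, isomorphic X Y -> le0 X -> le0 Y;
  ge1_strict : forall X Y, isomorphic X Y -> ge1 X -> ge1 Y;
  le0_shift : forall X, le0 X -> le0 (shift X);
  ge1_shift : forall X, ge1 X -> exists2 Y, ge1 Y & isomorphic X (shift Y);
  le0_ge1_hom : forall X Y (f : hom X Y), le0 X -> ge1 Y -> f = 0;
  trunc_le0 : T -> T;
  trunc_ge1 : T -> T;
  trunc_in : forall X, hom (trunc_le0 X) X;
  trunc_out : forall X, hom X (trunc_ge1 X);
  trunc_conn : forall X, hom (trunc_ge1 X) (shift (trunc_le0 X));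
  trunc_le0P : forall X, le0 (trunc_le0 X);
  trunc_ge1P : forall X, ge1 (trunc_ge1 X);
  trunc_distinguished : forall X,
    distinguished (trunc_in X) (trunc_out X) (trunc_conn X)
}.

Section TStructure.
Variables (k : closedFieldType) (T : triangulated k) (t : t_structure T).

(* D^{<=n} = Σ^{-n} D^{<=0}, closed under isomorphism *)
Definition Dle (n : int) (X : T) : Prop :=
  exists2 Y, le0 t Y & isomorphic X (shiftn (- n) Y).

(* D^{>=n} = Σ^{-(n-1)} D^{>=1}, closed under isomorphism *)
Definition Dge (n : int) (X : T) : Prop :=
  exists2 Y, ge1 t Y & isomorphic X (shiftn (- (n - 1)) Y).

Definition heart (X : T) : Prop := Dle 0 X /\ Dge 0 X.

Definition heart_category : category k := full_subcategory heart.

(* Truncations for the shifted t-structure (D^{<=n}, D^{>=n+1}), obtained by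
   transporting those of t along Σ^n. *)
Definition tau_le (n : int) (X : T) : T :=
  shiftn (- n) (trunc_le0 t (shiftn n X)).

Definition tau_ge (n : int) (X : T) : T :=
  shiftn (- (n - 1)) (trunc_ge1 t (shiftn (n - 1) X)).

Definition H0 (X : T) : T := tau_le 0 (tau_ge 0 X).

Definition bounded : Prop :=
  (forall X, exists n, Dle n X) /\ (forall X, exists n, Dge n X).

End TStructure.

Section MonoidalTStructure.
Variables (k : closedFieldType) (T : monoidal_triangulated k).
Variable t : t_structure T.

Definition dev (n : int) : Prop :=
  (forall X Y, Dle t 0 X -> Dle t n Y -> Dle t 0 (tens (mt_monoidal T) X Y)) /\
  (forall X Y, Dge t 0 X -> Dge t n Y -> Dge t 0 (tens (mt_monoidal T) X Y)).

Definition monoidal_t_structure : Prop := bounded t /\ exists n, dev n.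

End MonoidalTStructure.

(* Main.v *)
From mathcomp Require Import all_boot all_algebra.
From Stdlib Require Import IndefiniteDescription.
Require Import Defs.

(** Why the theorem is true.

    The heart is abelian by the argument of Beilinson, Bernstein and Deligne.
    [D^{<=0}] is the left orthogonal of [D^{>=1}], and [D^{>=0}] is the right
    orthogonal of [Σ D^{<=0}] ([le0P], [ge0P]), so every membership below is a
    diagram chase in the long exact Hom sequences of a triangle. For
    [f : X -> Y] in the heart with cone [C], the truncation triangle
    [ΣK -> C -> Q -> ΣΣK] has [K] and [Q] in the heart, and [K] and [Q] are the
    kernel and the cokernel of [f] ([heart_cone], [cone_kernel],
    [cone_cokernel]). If [f] is monic then [K = 0] and [C] is [Q]; if [f] is epic
    then [Q = 0] and [C] is [ΣK]; in both cases the cone triangle of [f] exhibits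
    [f] as a kernel, respectively a cokernel. The same analysis shows that short
    exact sequences of the heart are the triangles of [T] with vertices in the
    heart ([distinguished_short_exact], [short_exact_distinguished]).

    Because [0] is in the deviation, the heart is closed under the tensor product
    and, for [X] in the heart, the triangulated functors [X ⊗ -] and [- ⊗ X]
    preserve both [D^{<=0}] and [D^{>=0}]. They preserve triangles in the heart,
    so the tensor product of the heart is biexact
    ([exact_functor_short_exact]).

    For the unit, truncation gives a zigzag [1 -> τ^{>=0} 1 <- H^0(1)]. Let [F] be
    one of the functors above. It commutes with truncation, and [F 1] is
    isomorphic to [X], already in the heart, so [F] inverts both arrows of the
    zigzag ([exact_functor_H0_zigzag]). The unit constraints of [1] are therefore
    transported along the zigzag to unit constraints of [H^0(1)] on the heart, and
    naturality and the triangle axiom are inherited ([restrict_monoidal]). *)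

Set Implicit Arguments.
Unset Strict Implicit.
Unset Printing Implicit Defensive.

Import GRing.Theory.
Local Open Scope ring_scope.
Local Open Scope cat_scope.

(** * Linear categories *)

Section LinearCategory.
Variables (k : closedFieldType) (C : category k).
Implicit Types X Y Z W : C.

Lemma comp0m X Y Z (f : hom X Y) : (0 : hom Y Z) ∘ f = 0.
Proof.
apply: (@addIr _ (0 ∘ f)); rewrite add0r.
by have := comp_linearl f 1 (0 : hom Y Z) 0; rewrite !scale1r addr0.
Qed.

Lemma compm0 X Y Z (g : hom Y Z) : g ∘ (0 : hom X Y) = 0.
Proof.
apply: (@addIr _ (g ∘ 0)); rewrite add0r.
by have := comp_linearr g 1 (0 : hom X Y) 0; rewrite !scale1r addr0.
Qed.

Lemma compDm X Y Z (g g' : hom Y Z) (f : hom X Y) :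
  (g + g') ∘ f = g ∘ f + g' ∘ f.
Proof. by have := comp_linearl f 1 g g'; rewrite !scale1r. Qed.

Lemma compmD X Y Z (g : hom Y Z) (f f' : hom X Y) :
  g ∘ (f + f') = g ∘ f + g ∘ f'.
Proof. by have := comp_linearr g 1 f f'; rewrite !scale1r. Qed.

Lemma compNm X Y Z (g : hom Y Z) (f : hom X Y) : (- g) ∘ f = - (g ∘ f).
Proof. by apply: (@addIr _ (g ∘ f)); rewrite -compDm !addNr comp0m. Qed.

Lemma compmN X Y Z (g : hom Y Z) (f : hom X Y) : g ∘ (- f) = - (g ∘ f).
Proof. by apply: (@addIr _ (g ∘ f)); rewrite -compmD !addNr compm0. Qed.

Lemma is_iso_comp X Y Z (g : hom Y Z) (f : hom X Y) :
  is_iso g -> is_iso f -> is_iso (g ∘ f).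
Proof.
move=> [g' [g'K gK']] [f' [f'K fK']]; exists (f' ∘ g'); split.
  by rewrite compA -(compA f') g'K compm1.
by rewrite compA -(compA g) fK' compm1.
Qed.

Lemma is_iso_id X : is_iso (idm X).
Proof. by exists (idm X); rewrite comp1m. Qed.

Lemma is_iso_mono X Y (f : hom X Y) : is_iso f -> mono f.
Proof.
by move=> [f' [f'K _]] W g h e; rewrite -(comp1m g) -(comp1m h) -f'K -!compA e.
Qed.

Lemma is_iso_epi X Y (f : hom X Y) : is_iso f -> epi f.
Proof.
by move=> [f' [_ fK']] W g h e; rewrite -(compm1 g) -(compm1 h) -fK' !compA e.
Qed.

Lemma is_zero_id X : idm X = 0 -> is_zero X.
Proof.
move=> e; split=> Y f; first by rewrite -(compm1 f) e compm0.
by rewrite -(comp1m f) e comp0m.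
Qed.

(** The inclusion of the kernel is zero, and by uniqueness of factorizations it
    is also monic. *)
Lemma mono_kernel_zero X Y K (f : hom X Y) (i : hom K X) :
  mono f -> is_kernel f i -> is_zero K.
Proof.
move=> mf [fi0 ker_i]; apply: is_zero_id.
have i0 : i = 0 by apply: mf; rewrite fi0 compm0.
have [u [_ uniq_u]] := ker_i K 0 (compm0 _ _).
by rewrite -(uniq_u (idm K)) ?compm1 // -(uniq_u 0) ?compm0.
Qed.

Lemma epi_cokernel_zero X Y Q (f : hom X Y) (p : hom Y Q) :
  epi f -> is_cokernel f p -> is_zero Q.
Proof.
move=> ef [pf0 coker_p]; apply: is_zero_id.
have p0 : p = 0 by apply: ef; rewrite pf0 comp0m.
have [u [_ uniq_u]] := coker_p Q 0 (comp0m _ _).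
by rewrite -(uniq_u (idm Q)) ?comp1m // -(uniq_u 0) ?comp0m.
Qed.

Lemma kernel_mono X Y K (f : hom X Y) (i : hom K X) : is_kernel f i -> mono i.
Proof.
move=> [fi0 ker_i] W g h e.
have [|u [_ uniq_u]] := ker_i W (i ∘ g); first by rewrite compA fi0 comp0m.
by rewrite -(uniq_u g) // -(uniq_u h).
Qed.

Lemma cokernel_unique X Y Q Q' (f : hom X Y) (p : hom Y Q) (p' : hom Y Q') :
  is_cokernel f p -> is_cokernel f p' ->
  exists c : hom Q Q', is_iso c /\ c ∘ p = p'.
Proof.
move=> [pf0 coker_p] [p'f0 coker_p'].
have [c [cp _]] := coker_p _ _ p'f0; have [d [dp' _]] := coker_p' _ _ pf0.
exists c; split=> //; exists d; split.
  have [u [_ uniq_u]] := coker_p _ _ pf0.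
  by rewrite -(uniq_u (d ∘ c)) -?compA ?cp // -(uniq_u (idm Q)) ?comp1m.
have [u [_ uniq_u]] := coker_p' _ _ p'f0.
by rewrite -(uniq_u (c ∘ d)) -?compA ?dp' // -(uniq_u (idm Q')) ?comp1m.
Qed.

End LinearCategory.

Section LinearFunctor.
Variables (k : closedFieldType) (C D : category k) (F : functor C D).

Lemma fmapD X Y (f f' : hom X Y) : fmap F (f + f') = fmap F f + fmap F f'.
Proof. by have := fmap_linear F 1 f f'; rewrite !scale1r. Qed.

Lemma fmap0 X Y : fmap F (0 : hom X Y) = 0.
Proof. by apply: (@addIr _ (fmap F 0)); rewrite -fmapD addr0 add0r. Qed.

Lemma fmapN X Y (f : hom X Y) : fmap F (- f) = - fmap F f.
Proof. by apply: (@addIr _ (fmap F f)); rewrite -fmapD !addNr fmap0. Qed.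

Lemma fmap_iso X Y (f : hom X Y) : is_iso f -> is_iso (fmap F f).
Proof.
by move=> [g [gf fg]]; exists (fmap F g); rewrite -!fmap_comp gf fg !fmap_id.
Qed.

End LinearFunctor.

(** * Triangulated categories *)

Section Triangulated.
Variables (k : closedFieldType) (T : triangulated k).
Implicit Types X Y Z W : T.

Local Notation Σ := (@shift k T).
Local Notation Σm f := (fmap (@shift k T) f).

Lemma shift_faithful X Y (f f' : hom X Y) : Σm f = Σm f' -> f = f'.
Proof.
by move=> e; apply: (is_iso_mono (shiftK_iso Y)); rewrite !shiftK_natural e.
Qed.

Lemma shift_eq0 X Y (f : hom X Y) : Σm f = 0 -> f = 0.
Proof. by move=> e; apply: shift_faithful; rewrite e fmap0. Qed.

Lemma unshift_faithful X Y (f f' : hom X Y) :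
  fmap (@unshift k T) f = fmap unshift f' -> f = f'.
Proof.
move=> e; apply: (is_iso_epi (unshiftK_iso X)).
by rewrite -!unshiftK_natural e.
Qed.

(** The candidate is the transport of [unshift g] along [shiftK]; its shift is
    [g] because [unshift] is faithful, by the other half of the equivalence. *)
Lemma shift_full X Y (g : hom (Σ X) (Σ Y)) : exists f : hom X Y, g = Σm f.
Proof.
have [s [_ sK]] := shiftK_iso Y.
exists (s ∘ (fmap unshift g ∘ shiftK X)).
apply: unshift_faithful; apply: (is_iso_epi (shiftK_iso X)).
by rewrite -shiftK_natural compA sK comp1m.
Qed.

Lemma shift_zero X : is_zero X -> is_zero (Σ X).
Proof.
by move=> [X0 _]; apply: is_zero_id; rewrite -fmap_id (X0 _ (idm X)) fmap0.
Qed.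

Section Triangle.
Variables (X Y Z : T) (f : hom X Y) (g : hom Y Z) (h : hom Z (Σ X)).
Hypothesis fgh : distinguished f g h.

Lemma distinguished_comp0 : g ∘ f = 0.
Proof.
have [[O O0] _] := tcat_additive T.
have [|c [e _]] := distinguished_morphism (a := idm X) (b := f)
  (distinguished_id X O0) fgh; first by [].
by rewrite -e compm0.
Qed.

(** The morphism axiom completes on the right only. It is applied to the rotated
    triangles [W -> 0 -> ΣW] and [Y -> Z -> ΣX], which gives the shift of the
    wanted factorization. *)
Lemma distinguished_lift W (u : hom W Y) :
  g ∘ u = 0 -> exists v : hom W X, u = f ∘ v.
Proof.
have [[O O0] _] := tcat_additive T => gu0.
have idW := proj1 (distinguished_rotate _ _ _) (distinguished_id W O0).
have gh := proj1 (distinguished_rotate _ _ _) fgh.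
have [|c [_ e]] := distinguished_morphism (a := u) (b := 0) idW gh.
  by rewrite gu0 compm0.
have [v cE] := shift_full c; exists v; apply: shift_faithful.
move: e; rewrite cE compmN compNm -!fmap_comp compm1.
exact: oppr_inj.
Qed.

(** The comparison is with the triangle [0 -> W -> W], whose middle map is the
    identity. *)
Lemma distinguished_extend W (v : hom Y W) :
  v ∘ f = 0 -> exists w : hom Z W, v = w ∘ g.
Proof.
have [[O O0] _] := tcat_additive T => vf0.
have tri : distinguished (0 : hom O W) (idm W) (0 : hom W (Σ O)).
  apply: (proj2 (distinguished_rotate _ _ _)); rewrite fmap0 oppr0.
  exact: distinguished_id (shift_zero O0).
have [|w [e _]] := distinguished_morphism (a := 0) (b := v) fgh tri.
  by rewrite vf0 comp0m.
by exists w; rewrite e comp1m.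
Qed.

End Triangle.

Section TriangleShifted.
Variables (X Y Z : T) (f : hom X Y) (g : hom Y Z) (h : hom Z (Σ X)).
Hypothesis fgh : distinguished f g h.

Let gh : distinguished g h (- Σm f).
Proof. exact: (proj1 (distinguished_rotate _ _ _)). Qed.

Let hf : distinguished h (- Σm f) (- Σm g).
Proof. exact: (proj1 (distinguished_rotate _ _ _)). Qed.

Lemma distinguished_comp0_last : Σm f ∘ h = 0.
Proof.
by apply: oppr_inj; rewrite -compNm oppr0; apply: distinguished_comp0 hf.
Qed.

Lemma distinguished_lift_mid W (u : hom W Z) :
  h ∘ u = 0 -> exists v : hom W Y, u = g ∘ v.
Proof. exact: distinguished_lift gh W u. Qed.

Lemma distinguished_extend_mid W (v : hom Z W) :
  v ∘ g = 0 -> exists w : hom (Σ X) W, v = w ∘ h.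
Proof. exact: distinguished_extend gh W v. Qed.

Lemma distinguished_lift_last W (u : hom W X) :
  f ∘ u = 0 -> exists v : hom (Σ W) Z, Σm u = h ∘ v.
Proof.
move=> fu0; apply: (distinguished_lift hf).
by rewrite compNm -fmap_comp fu0 fmap0 oppr0.
Qed.

Lemma distinguished_extend_last W (v : hom X W) :
  Σm v ∘ h = 0 -> exists w : hom Y W, v = w ∘ f.
Proof.
move=> vh0; have [w e] := distinguished_extend hf vh0.
have [w' wE] := shift_full w; exists (- w'); apply: shift_faithful.
by rewrite e wE fmap_comp fmapN compNm compmN.
Qed.

(** When [g = 0], exactness splits [f] on one side; the defect of the other
    composite factors through a map [ΣX -> Z], so the vanishing of these makes
    [f] invertible. This and the dual lemma below express that the truncation
    triangle of an object which is already on one side is trivial. *)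
Lemma distinguished_iso_fst :
  g = 0 -> (forall v : hom (Σ X) Z, v = 0) -> is_iso f.
Proof.
move=> g0 XZ0; have [|s fs] := distinguished_lift fgh (u := idm Y).
  by rewrite g0 comp0m.
exists s; split=> //; apply/eqP; rewrite -subr_eq0; apply/eqP.
have [|v e] := distinguished_lift_last (u := s ∘ f - idm X).
  by rewrite compmD compmN compm1 compA -fs comp1m subrr.
by apply: shift_eq0; rewrite e (XZ0 v) compm0.
Qed.

Lemma distinguished_iso_snd :
  f = 0 -> (forall v : hom (Σ X) Z, v = 0) -> is_iso g.
Proof.
move=> f0 XZ0; have [|s sg] := distinguished_extend fgh (v := idm Y).
  by rewrite f0 compm0.
exists s; split=> //; apply/eqP; rewrite -subr_eq0; apply/eqP.
have [|v ->] := distinguished_extend_mid (v := g ∘ s - idm Z).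
  by rewrite compDm compNm comp1m -compA -sg compm1 subrr.
by rewrite (XZ0 v) comp0m.
Qed.

End TriangleShifted.

(** The signs produced by three rotations cancel against the automorphism [-1]
    of the middle term. *)
Lemma distinguished_shift X Y Z (f : hom X Y) (g : hom Y Z) (h : hom Z (Σ X)) :
  distinguished f g h -> distinguished (Σm f) (Σm g) (- Σm h).
Proof.
move=> fgh; have rotate := fun X Y Z f g h =>
  proj1 (@distinguished_rotate _ T X Y Z f g h).
move: (rotate _ _ _ _ _ _ (rotate _ _ _ _ _ _ (rotate _ _ _ _ _ _ fgh))).
have isoN : is_iso (- idm (Σ Y)).
  by exists (- idm _); rewrite compNm compmN comp1m opprK.
apply: (distinguished_iso (is_iso_id _) isoN (is_iso_id _)).
- by rewrite compNm compmN opprK comp1m compm1.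
- by rewrite !compmN compm1 comp1m.
- by rewrite fmap_id compm1 comp1m.
Qed.

End Triangulated.

(** * Truncation and Hom-vanishing *)

Section TStructure.
Variables (k : closedFieldType) (T : triangulated k) (t : t_structure T).
Implicit Types X Y Z W L : T.

Local Notation Σ := (@shift k T).
Local Notation Σm f := (fmap (@shift k T) f).

Local Notation ge0 := (Dge t 0).

(** This truncation triangle for [(D^{<=-1}, D^{>=0})] is the shift of the given
    one of [Σ^{-1}X]. *)
Lemma trunc_ge0_distinguished X :
  exists (p : hom (Σ (trunc_le0 t (unshift X))) X)
    (q : hom X (tau_ge t 0 X)) r,
    distinguished p q r.
Proof.
have d := distinguished_shift (trunc_distinguished t (unshift X)).
have [s [sK Ks]] := unshiftK_iso X.
set p := Σm _ in d; set q := Σm _ in d.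
exists (unshiftK X ∘ p), (q ∘ s), (- Σm (trunc_conn t (unshift X))).
apply: distinguished_iso d; [exact: is_iso_id | exact: unshiftK_iso
  | exact: is_iso_id | | |].
- by rewrite compm1.
- by rewrite comp1m -compA sK compm1.
- by rewrite fmap_id comp1m compm1.
Qed.

Lemma Dle0E X : Dle t 0 X <-> le0 t X.
Proof.
split=> [[Y leY [f [g [gf fg]]]]|leX]; last first.
  by exists X => //; exists (idm X); apply: is_iso_id.
by apply: le0_strict leY; exists g; exists f.
Qed.

Lemma ge0_hom L X (u : hom (Σ L) X) : le0 t L -> ge0 X -> u = 0.
Proof.
move=> leL [Y geY [f iso_f]].
have [v e] := shift_full (f ∘ u : hom _ (Σ Y)).
apply: (is_iso_mono iso_f); rewrite compm0 e.
by rewrite (le0_ge1_hom v leL geY) fmap0.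
Qed.

Lemma tau_ge0P X : ge0 (tau_ge t 0 X).
Proof.
exists (trunc_ge1 t (unshift X)); first exact: trunc_ge1P.
by exists (idm _); apply: is_iso_id.
Qed.

Lemma le0P X : le0 t X <-> forall Z (u : hom X Z), ge1 t Z -> u = 0.
Proof.
split=> [leX Z u geZ|X0]; first exact: le0_ge1_hom leX geZ.
apply: le0_strict (trunc_le0P t X); exists (trunc_in t X).
apply: (distinguished_iso_fst (trunc_distinguished t X)).
  exact: X0 (trunc_ge1P t X).
move=> v; apply: le0_ge1_hom (trunc_ge1P t X).
exact: le0_shift (trunc_le0P t X).
Qed.

Lemma ge0P X : ge0 X <-> forall L (u : hom (Σ L) X), le0 t L -> u = 0.
Proof.
split=> [geX L u leL|X0]; first exact: ge0_hom leL geX.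
have [p [q [r pqr]]] := trunc_ge0_distinguished X.
exists (trunc_ge1 t (unshift X)); first exact: trunc_ge1P.
exists q; apply: (distinguished_iso_snd pqr).
  exact: X0 (trunc_le0P _ _).
move=> v; apply: ge0_hom (tau_ge0P X).
exact: le0_shift (trunc_le0P _ _).
Qed.

Lemma ge1P X : ge1 t X <-> ge0 (Σ X).
Proof.
split=> [geX|geX]; first by exists X => //; exists (idm _); apply: is_iso_id.
apply: ge1_strict (trunc_ge1P t X).
have out_iso : is_iso (trunc_out t X).
  apply: (distinguished_iso_snd (trunc_distinguished t X)).
    by apply: shift_eq0; apply: ge0_hom (trunc_le0P t X) geX.
  move=> v; apply: le0_ge1_hom (trunc_ge1P t X).
  exact: le0_shift (trunc_le0P t X).
by have [g [gf fg]] := out_iso; exists g; exists (trunc_out t X).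
Qed.

Lemma heartP X : heart t X <->
  (forall Z (u : hom X Z), ge1 t Z -> u = 0) /\
  (forall L (u : hom (Σ L) X), le0 t L -> u = 0).
Proof. by rewrite /heart Dle0E le0P ge0P. Qed.

Lemma heart_le0 X : heart t X -> le0 t X.
Proof. by case=> /Dle0E. Qed.

Lemma heart_iso X Y (f : hom X Y) : is_iso f -> heart t X -> heart t Y.
Proof.
move=> iso_f /heartP[X0 X1]; have [g [gf fg]] := iso_f.
apply/heartP; split=> [Z u geZ|L u leL].
  by apply: (is_iso_epi iso_f); rewrite comp0m; apply: X0.
have iso_g : is_iso g by exists f.
by apply: (is_iso_mono iso_g); rewrite compm0; apply: X1.
Qed.

Lemma zero_heart X : is_zero X -> heart t X.
Proof. by move=> [X0 X1]; apply/heartP; split. Qed.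

Lemma biproduct_heart X Y S (i1 : hom X S) (i2 : hom Y S) p1 p2 :
  heart t X -> heart t Y -> is_biproduct i1 i2 p1 p2 -> heart t S.
Proof.
move=> /heartP[X0 X1] /heartP[Y0 Y1] [_ _ _ _ idS].
apply/heartP; split=> [Z u geZ|L u leL].
  rewrite -(compm1 u) -idS compmD !compA (X0 _ (u ∘ i1) geZ) //.
  by rewrite (Y0 _ (u ∘ i2) geZ) // !comp0m addr0.
rewrite -(comp1m u) -idS compDm -!compA (X1 _ (p1 ∘ u) leL) //.
by rewrite (Y1 _ (p2 ∘ u) leL) // !compm0 addr0.
Qed.

Lemma H0_distinguished X :
  exists (v : hom (H0 t X) (tau_ge t 0 X)) g h,
    distinguished v (g : hom _ (trunc_ge1 t (tau_ge t 0 X))) h.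
Proof. by do 3!eexists; apply: trunc_distinguished. Qed.

(** In [H^0(X) -> τ^{>=0} X -> G] with [G] in [D^{>=1}], a map from [ΣL] to the
    first term dies in the second, hence comes from a map [ΣΣL -> G] after one
    shift. *)
Lemma H0_heart X : heart t (H0 t X).
Proof.
split; first exact/Dle0E/trunc_le0P.
have [v [g [h vgh]]] := H0_distinguished X.
apply/ge0P => L u leL.
have [|w e] := distinguished_lift_last vgh (u := u).
  exact: ge0_hom leL (tau_ge0P X).
apply: shift_eq0; rewrite e (le0_ge1_hom (t := t) w) ?compm0 //.
  by do 2!apply: le0_shift.
exact: trunc_ge1P.
Qed.


Lemma ge0_iso X Y (f : hom X Y) : is_iso f -> ge0 Y -> ge0 X.
Proof.
move=> iso_f [Z geZ [g iso_g]]; exists Z => //.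
by exists (g ∘ f); apply: is_iso_comp.
Qed.

End TStructure.

(** * The heart is abelian *)

Section Heart.
Variables (k : closedFieldType) (T : triangulated k) (t : t_structure T).

Local Notation Σ := (@shift k T).
Local Notation Σm f := (fmap (@shift k T) f).
Local Notation heart_cat := (heart_category t).
Local Notation ge0 := (Dge t 0).

(** This vanishing of the negative extensions turns the weak (co)kernels of a
    triangulated category into actual ones in the heart. *)
Lemma heart_hom0 (X Y : heart_cat) (u : @hom k T (Σ (sval X)) (sval Y)) : u = 0.
Proof. exact: ge0_hom (heart_le0 (svalP X)) (proj2 (svalP Y)). Qed.

Lemma heart_is_kernel (X Y K : heart_cat) (f : hom X Y) (i : hom K X) :
  f ∘ i = 0 ->
  (forall W (u : hom W X), f ∘ u = 0 -> exists v : hom W K, u = i ∘ v) ->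
  (forall W (v : hom W K), i ∘ v = 0 -> v = 0) -> is_kernel f i.
Proof.
move=> fi0 lift inj; split=> // W u /lift[v ->]; exists v; split=> // v' e.
apply/eqP; rewrite -subr_eq0; apply/eqP; apply: inj.
by rewrite compmD compmN e subrr.
Qed.

Lemma heart_is_cokernel (X Y Q : heart_cat) (f : hom X Y) (p : hom Y Q) :
  p ∘ f = 0 ->
  (forall W (u : hom Y W), u ∘ f = 0 -> exists v : hom Q W, u = v ∘ p) ->
  (forall W (v : hom Q W), v ∘ p = 0 -> v = 0) -> is_cokernel f p.
Proof.
move=> pf0 ext inj; split=> // W u /ext[v ->]; exists v; split=> // v' e.
apply/eqP; rewrite -subr_eq0; apply/eqP; apply: inj.
by rewrite compDm compNm e subrr.
Qed.

Lemma distinguished_short_exact (X Y Z : heart_cat) (f : hom X Y) (g : hom Y Z)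
    (h : @hom k T (sval Z) (Σ (sval X))) :
  @distinguished k T _ _ _ f g h -> short_exact f g.
Proof.
move=> fgh; split.
  apply: heart_is_kernel => [|W u|W v fv0].
  - exact: (distinguished_comp0 fgh).
  - exact: (distinguished_lift fgh).
  - have [w e] := distinguished_lift_last fgh fv0.
    by apply: shift_eq0; rewrite e (heart_hom0 w) compm0.
apply: heart_is_cokernel => [|W u|W v vg0].
- exact: (distinguished_comp0 fgh).
- exact: (distinguished_extend fgh).
- have [w ->] := distinguished_extend_mid fgh vg0.
  by rewrite (heart_hom0 w) comp0m.
Qed.

(** Since [X] and [Y] lie in the heart, the cone [C] lies in [D^{<=0}] and receives
    no map from [Σ^2 D^{<=0}]; this leaves only two cohomology objects, [K] in
    degree [-1] and [Q] in degree [0]. *)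
Lemma heart_cone (X Y : heart_cat) (f : hom X Y) :
  exists (C : T) (g : hom (sval Y) C) (h : hom C (Σ (sval X))) (K Q : heart_cat)
    (p : @hom k T (Σ (sval K)) C) (q : @hom k T C (sval Q)) r,
    @distinguished k T _ _ _ f g h /\ @distinguished k T _ _ _ p q r.
Proof.
have [C [g [h fgh]]] := @distinguished_cone k T _ _ f.
have [p [q [r pqr]]] := trunc_ge0_distinguished t C.
have [X0 X1] := (iffLR (heartP _ _) (svalP X)).
have [Y0 Y1] := (iffLR (heartP _ _) (svalP Y)).
set K := trunc_le0 t (unshift C) in p r pqr *.
have leK : le0 t K := trunc_le0P _ _.
have geQ : ge0 (tau_ge t 0 C) := tau_ge0P _ _.
have C0 Z (u : hom C Z) : ge1 t Z -> u = 0.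
  move=> geZ; have [|v ->] := distinguished_extend_mid fgh (v := u).
    exact: Y0.
  rewrite (le0_ge1_hom (t := t) v) ?comp0m //.
  exact: le0_shift (heart_le0 (svalP X)).
have C2 L (u : hom (Σ (Σ L)) C) : le0 t L -> u = 0.
  move=> leL; have [|v ->] := distinguished_lift_mid fgh (u := u).
    have [w ->] := shift_full (h ∘ u).
    by rewrite (X1 _ w leL) fmap0.
  by rewrite (Y1 _ v (le0_shift leL)) compm0.
have heartK : heart t K.
  split; first exact/Dle0E.
  apply/ge0P => L u leL; apply: shift_eq0.
  have [|v e] := distinguished_lift_last pqr (u := Σm u); first exact: C2.
  apply: shift_eq0; rewrite e (ge0_hom v _ geQ) ?compm0 //.
  by do 2!apply: le0_shift.
have heartQ : heart t (tau_ge t 0 C).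
  split=> //; apply/Dle0E/le0P => Z u geZ.
  have [|v ->] := distinguished_extend_mid pqr (v := u); first exact: C0.
  by rewrite (le0_ge1_hom (t := t) v) ?comp0m //; do 2!apply: le0_shift.
by exists C, g, h, (exist _ K heartK), (exist _ _ heartQ), p, q, r.
Qed.

Section Cone.
Variables (X Y : heart_cat) (f : hom X Y) (C : T).
Variables (g : @hom k T (sval Y) C) (h : @hom k T C (Σ (sval X))).
Variables (K Q : heart_cat) (p : @hom k T (Σ (sval K)) C).
Variables (q : @hom k T C (sval Q)) (r : @hom k T (sval Q) (Σ (Σ (sval K)))).
Hypothesis fgh : @distinguished k T _ _ _ f g h.
Hypothesis pqr : @distinguished k T _ _ _ p q r.

Lemma heart_shift2_hom0 (X' Y' : heart_cat)
  (u : @hom k T (Σ (Σ (sval X'))) (sval Y')) : u = 0.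
Proof. exact: ge0_hom (le0_shift (heart_le0 (svalP X'))) (proj2 (svalP Y')). Qed.

(** A map killed by [f] lifts, after a shift, through [h] to [ΣW -> C], which
    factors through [p] because [ΣW -> Q] vanishes. *)
Lemma cone_kernel (i : hom K X) : Σm i = h ∘ p -> is_kernel f i.
Proof.
move=> iE; apply: heart_is_kernel => [|W u fu0|W v iv0].
- apply: (@shift_eq0 k T); rewrite (fmap_comp (@shift k T)) iE compA.
  by rewrite (distinguished_comp0_last fgh) comp0m.
- have [v e] := distinguished_lift_last fgh fu0.
  have [|w vE] := distinguished_lift pqr (u := v); first exact: heart_hom0.
  have [w' wE] := shift_full w; exists w'.
  apply: (@shift_faithful k T); rewrite (fmap_comp (@shift k T)).
  by rewrite e vE wE iE compA.
have [|y e] := distinguished_lift_mid fgh (u := p ∘ Σm (v : @hom k T _ _)).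
  by rewrite compA -iE -fmap_comp (iv0 : @comp k T _ _ _ i v = 0) fmap0.
rewrite (heart_hom0 y) compm0 in e.
have [z zE] := distinguished_lift_last pqr e.
do 2!apply: (@shift_eq0 k T).
by rewrite zE (heart_shift2_hom0 z) compm0.
Qed.

Lemma cone_cokernel : @is_cokernel k heart_cat _ _ _ f (q ∘ g).
Proof.
apply: heart_is_cokernel => [|W u uf0|W v vqg0].
- rewrite /= -(@compA k T).
  by rewrite (distinguished_comp0 fgh) (@compm0 k T).
- have [v e] := distinguished_extend fgh uf0.
  have [|w wE] := distinguished_extend pqr (v := v); first exact: heart_hom0.
  by exists w; rewrite e wE -compA.
have [|y e] := distinguished_extend_mid fgh (v := (v : @hom k T _ _) ∘ q).
  by rewrite -compA.
rewrite (heart_hom0 y) comp0m in e.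
have [z ->] := distinguished_extend_mid pqr e.
by rewrite (heart_shift2_hom0 z) comp0m.
Qed.

(** A monomorphism has [K = 0], so that [q] identifies its cone with its
    cokernel. *)
Lemma cone_mono (i : hom K X) : Σm i = h ∘ p -> mono f ->
  exists h', @distinguished k T _ _ _ f (q ∘ g) h'.
Proof.
move=> iE mf; have [K0 _] := mono_kernel_zero mf (cone_kernel iE).
have p0 : p = 0.
  apply: (proj1 (shift_zero (X := sval K) _)); apply: is_zero_id; exact: K0.
have iso_q : is_iso q.
  by apply: (distinguished_iso_snd pqr p0) => v; apply: heart_shift2_hom0.
have [q' [q'q qq']] := iso_q.
exists (h ∘ q'); apply: distinguished_iso fgh;
  [exact: is_iso_id | exact: is_iso_id | exact: iso_q | | |].
- by rewrite comp1m compm1.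
- by rewrite compm1.
- by rewrite fmap_id comp1m -compA q'q compm1.
Qed.

(** An epimorphism has [Q = 0], so that [p] is epic; a map killed by [i] is then
    killed, after a shift, by [h], and extends along [f]. *)
Lemma cone_epi (i : hom K X) : Σm i = h ∘ p -> epi f -> is_cokernel i f.
Proof.
move=> iE ef; have [_ Q0] := epi_cokernel_zero ef cone_cokernel.
have epi_p W (u : hom C W) : u ∘ p = 0 -> u = 0.
  case/(distinguished_extend pqr) => v ->.
  suff -> : q = 0 by rewrite compm0.
  have idQ : @idm k T (sval Q) = 0 := Q0 Q (idm Q).
  by rewrite -(comp1m q) idQ comp0m.
apply: heart_is_cokernel => [|W u ui0|W v vf0].
- exact: proj1 (cone_kernel iE).
- apply: (distinguished_extend_last fgh); apply: epi_p.
  by rewrite -compA -iE -fmap_comp (ui0 : @comp k T _ _ _ u i = 0) fmap0.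
- by apply: ef; rewrite vf0 comp0m.
Qed.

End Cone.

Lemma heart_abelian : abelian_category heart_cat.
Proof.
have [[O O0] biprod] := tcat_additive T; split.
- split=> [|X Y].
    exists (exist _ O (zero_heart t O0)).
    by split=> X u; [apply: (proj1 O0) | apply: (proj2 O0)].
  have [S [i1 [i2 [p1 [p2 bS]]]]] := biprod (sval X) (sval Y).
  exists (exist _ S (biproduct_heart (svalP X) (svalP Y) bS)).
  by exists i1, i2, p1, p2.
- move=> X Y f; have [C [g [h [K [Q [p [q [r [fgh pqr]]]]]]]]] := heart_cone f.
  have [i iE] := shift_full (h ∘ p).
  by exists K, i; apply: (cone_kernel fgh pqr).
- move=> X Y f; have [C [g [h [K [Q [p [q [r [fgh pqr]]]]]]]]] := heart_cone f.
  by exists Q, (q ∘ g); apply: (cone_cokernel fgh pqr).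
- move=> X Y f mf; have [C [g [h [K [Q [p [q [r [fgh pqr]]]]]]]]] := heart_cone f.
  have [i iE] := shift_full (h ∘ p).
  have [h' d] := cone_mono fgh pqr (esym iE) mf.
  by exists Q, (q ∘ g); have [] := distinguished_short_exact d.
- move=> X Y f ef; have [C [g [h [K [Q [p [q [r [fgh pqr]]]]]]]]] := heart_cone f.
  have [i iE] := shift_full (h ∘ p).
  by exists K, i; apply: (cone_epi fgh pqr (esym iE) ef).
Qed.

(** The cone triangle of the monomorphism [f] ends in a cokernel of [f], which is
    unique up to isomorphism. *)
Lemma short_exact_distinguished (X Y Z : heart_cat) (f : hom X Y) (g : hom Y Z) :
  short_exact f g -> exists h, @distinguished k T _ _ _ f g h.
Proof.
move=> [ker_f coker_g].
have [C [g1 [h [K [Q [p [q [r [fgh pqr]]]]]]]]] := heart_cone f.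
have [i iE] := shift_full (h ∘ p).
have [h' d] := cone_mono fgh pqr (esym iE) (kernel_mono ker_f).
have [_ coker_q] := distinguished_short_exact d.
have [c [[c' [c'c cc']] cq]] := cokernel_unique coker_q coker_g.
have iso_c : @is_iso k T (sval Q) (sval Z) c by exists c'.
exists (@comp k T _ _ _ h' c'); apply: distinguished_iso d;
  [exact: is_iso_id | exact: is_iso_id | exact: iso_c | | |].
- by rewrite comp1m compm1.
- by rewrite compm1.
- by rewrite fmap_id comp1m -compA (c'c : @comp k T _ _ _ c' c = idm _) compm1.
Qed.

End Heart.

(** * Triangulated functors exact for the t-structure *)

Section ExactFunctor.
Variables (k : closedFieldType) (T : triangulated k) (t : t_structure T).
Variables (F : functor T T) (phi : forall X, hom (F (shift X)) (shift (F X))).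
Hypothesis phi_iso : forall X, is_iso (phi X).
Hypothesis F_triangulated : triangulated_functor phi.
Hypothesis F_le0 : forall X, le0 t X -> le0 t (F X).
Hypothesis F_ge0 : forall X, Dge t 0 X -> Dge t 0 (F X).

Lemma exact_functor_ge1 X : ge1 t X -> ge1 t (F X).
Proof.
move=> geX; apply/ge1P; have [g [gphi phig]] := phi_iso X.
have iso_g : is_iso g by exists (phi X).
by apply: ge0_iso iso_g _; apply: F_ge0; apply/ge1P.
Qed.

(** The image triangle truncates [F U], which already lies in [D^{>=0}]. *)
Lemma exact_functor_iso_ge0 K U E (p : hom (shift K) U) (e : hom U E) r :
  distinguished p e r -> le0 t K -> Dge t 0 E -> heart t (F U) ->
  is_iso (fmap F e).
Proof.
move=> d leK geE heartFU; have [g [gphi phig]] := phi_iso K.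
apply: (distinguished_iso_snd (F_triangulated d)).
  rewrite -(compm1 (fmap F p)) -gphi compA.
  rewrite (ge0_hom (fmap F p ∘ g) _ (proj2 heartFU)) ?comp0m //.
  exact: F_le0.
move=> v; apply: ge0_hom (F_ge0 geE); apply: F_le0; exact: le0_shift.
Qed.

(** The image triangle truncates [F E], which already lies in [D^{<=0}]. *)
Lemma exact_functor_iso_le0 H E G (v : hom H E) (g : hom E G) h :
  distinguished v g h -> le0 t H -> ge1 t G -> heart t (F E) ->
  is_iso (fmap F v).
Proof.
move=> d leH geG heartFE.
apply: (distinguished_iso_fst (F_triangulated d)) => [|u].
  by apply: le0_ge1_hom (heart_le0 heartFE) (exact_functor_ge1 geG).
apply: le0_ge1_hom (exact_functor_ge1 geG); exact/le0_shift/F_le0.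
Qed.

Lemma exact_functor_H0_zigzag U p (e : hom U (tau_ge t 0 U)) r
    (v : hom (H0 t U) (tau_ge t 0 U)) g h :
  @distinguished k T (shift (trunc_le0 t (unshift U))) _ _ p e r ->
  @distinguished k T _ _ (trunc_ge1 t (tau_ge t 0 U)) v g h ->
  heart t (F U) -> is_iso (fmap F e) /\ is_iso (fmap F v).
Proof.
move=> per vgh heartFU.
have iso_e : is_iso (fmap F e).
  exact: exact_functor_iso_ge0 per (trunc_le0P _ _) (tau_ge0P t U) heartFU.
split=> //; apply: (exact_functor_iso_le0 vgh (trunc_le0P _ _)).
  exact: trunc_ge1P.
exact: heart_iso iso_e heartFU.
Qed.

Lemma exact_functor_short_exact (X Y Z : heart_category t) (f : hom X Y)
    (g : hom Y Z) hX hY hZ :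
  short_exact f g ->
  @short_exact k (heart_category t) (exist _ (F (sval X)) hX)
    (exist _ (F (sval Y)) hY) (exist _ (F (sval Z)) hZ) (fmap F f) (fmap F g).
Proof.
move=> /short_exact_distinguished[h d].
exact: (@distinguished_short_exact _ _ t (exist _ _ hX) (exist _ _ hY)
  (exist _ _ hZ) _ _ _ (F_triangulated d)).
Qed.

End ExactFunctor.

(** * Transport of the unit to a full subcategory *)

Section RestrictMonoidal.
Variables (k : closedFieldType) (C : category k) (M : monoidal C).
Variables (P : C -> Prop) (P_closed : tensor_closed M P).
Variables (H E : C) (PH : P H) (e : hom (tunit M) E) (v : hom H E).
Hypothesis e_isol : forall X, P X -> is_iso (tensm M e (idm X)).
Hypothesis e_isor : forall X, P X -> is_iso (tensm M (idm X) e).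
Hypothesis v_isol : forall X, P X -> is_iso (tensm M v (idm X)).
Hypothesis v_isor : forall X, P X -> is_iso (tensm M (idm X) v).

(** On objects of [P], the arrow [e] becomes invertible after tensoring, so the
    unit constraints of [M] factor uniquely through it; composing the factors
    with [v] gives those of [H]. Every identity is checked after precomposing
    with the invertible tensor of [e], where it becomes an identity of [M]. The
    inverses are only known to exist, and choosing one for each object uses
    indefinite description. *)
Lemma restrict_monoidal :
  exists N : monoidal (full_subcategory P),
    tensor N = restrict_tensor P_closed /\ sval (tunit N) = H.
Proof.
have factor (U V W : C) (a : hom U V) (b : hom U W) :
    is_iso a -> is_iso b -> {w : hom V W | is_iso w /\ w ∘ a = b}.
  move=> iso_a iso_b; apply: constructive_indefinite_description.
  have [a' [a'a aa']] := iso_a; exists (b ∘ a'); split.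
    by apply: is_iso_comp => //; exists a.
  by rewrite -compA a'a compm1.
have [lw [lw_iso lwE]] : exists lw : forall X : full_subcategory P,
    @hom k C (tens M E (sval X)) (sval X), (forall X, is_iso (lw X)) /\
    forall X, lw X ∘ tensm M e (idm (sval X)) = lunit M (sval X).
  pose s (X : full_subcategory P) :=
    factor _ _ _ _ _ (e_isol (svalP X)) (lunit_iso M (sval X)).
  by exists (fun X => sval (s X)); split=> X; case: (svalP (s X)).
have [rw [rw_iso rwE]] : exists rw : forall X : full_subcategory P,
    @hom k C (tens M (sval X) E) (sval X), (forall X, is_iso (rw X)) /\
    forall X, rw X ∘ tensm M (idm (sval X)) e = runit M (sval X).
  pose s (X : full_subcategory P) :=
    factor _ _ _ _ _ (e_isor (svalP X)) (runit_iso M (sval X)).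
  by exists (fun X => sval (s X)); split=> X; case: (svalP (s X)).
pose l X : @hom k C _ _ := lw X ∘ tensm M v (idm (sval X)).
pose r X : @hom k C _ _ := rw X ∘ tensm M (idm (sval X)) v.
have l_iso X : is_iso (l X).
  exact: is_iso_comp (lw_iso X) (v_isol (svalP X)).
have r_iso X : is_iso (r X).
  exact: is_iso_comp (rw_iso X) (v_isor (svalP X)).
have l_natural X Y (f : @hom k C (sval X) (sval Y)) :
    l Y ∘ tensm M (idm H) f = f ∘ l X.
  have wE : lw Y ∘ tensm M (idm E) f = f ∘ lw X.
    apply: (is_iso_epi (e_isol (svalP X))).
    rewrite -!compA lwE -tensm_comp comp1m compm1.
    rewrite -[e in LHS]compm1 -[f in LHS]comp1m tensm_comp compA lwE.
    exact: lunit_natural.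
  rewrite /l compA -wE -!compA -!tensm_comp.
  by rewrite !(comp1m, compm1).
have r_natural X Y (f : @hom k C (sval X) (sval Y)) :
    r Y ∘ tensm M f (idm H) = f ∘ r X.
  have wE : rw Y ∘ tensm M f (idm E) = f ∘ rw X.
    apply: (is_iso_epi (e_isor (svalP X))).
    rewrite -!compA rwE -tensm_comp comp1m compm1.
    rewrite -[e in LHS]compm1 -[f in LHS]comp1m tensm_comp compA rwE.
    exact: runit_natural.
  rewrite /r compA -wE -!compA -!tensm_comp.
  by rewrite !(comp1m, compm1).
have triangle X Y : tensm M (idm (sval X)) (l Y) ∘ assoc M (sval X) H (sval Y)
    = tensm M (r X) (idm (sval Y)).
  have wE : tensm M (idm (sval X)) (lw Y) ∘ assoc M (sval X) E (sval Y)
      = tensm M (rw X) (idm (sval Y)).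
    have iso_XeY : is_iso (tensm M (tensm M (idm (sval X)) e) (idm (sval Y))).
      exact: (fmap_iso (tensor_right M (sval Y)) (e_isor (svalP X))).
    apply: (is_iso_epi iso_XeY); rewrite -compA assoc_natural compA.
    rewrite -!tensm_comp !comp1m lwE rwE.
    exact: unit_triangle.
  have := congr1
    (fun a => a ∘ tensm M (tensm M (idm (sval X)) v) (idm (sval Y))) wE.
  by rewrite /= -compA assoc_natural compA -!tensm_comp !comp1m.
by exists (@Monoidal k (full_subcategory P) (restrict_tensor P_closed)
  (exist P H PH) l r l_iso r_iso l_natural r_natural triangle).
Qed.

End RestrictMonoidal.

Theorem proposition2p13 (k : closedFieldType) (T : monoidal_triangulated k)
    (t : t_structure T)
    (T_nonzero : exists X : T, ~ is_zero X)
    (t_monoidal : monoidal_t_structure t)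
    (dev0 : dev t 0%R) :
  abelian_category (heart_category t) /\
  exists (heart_closed : tensor_closed (mt_monoidal T) (heart t))
         (M : monoidal (heart_category t)),
    [/\ tensor M = restrict_tensor heart_closed,
        sval (tunit M) = H0 t (tunit (mt_monoidal T))
      & biexact M].
Proof.
split; first exact: heart_abelian.
have [tens_le0 tens_ge0] := dev0.
have heart_closed : tensor_closed (mt_monoidal T) (heart t).
  by move=> X Y [X0 X1] [Y0 Y1]; split; [apply: tens_le0 | apply: tens_ge0].
pose L X := tensor_left (mt_monoidal T) X.
pose R X := tensor_right (mt_monoidal T) X.
have L_le0 X Y : heart t X -> le0 t Y -> le0 t (L X Y).
  by move=> [X0 _] Y0; apply/Dle0E/tens_le0 => //; apply/Dle0E.
have R_le0 X Y : heart t X -> le0 t Y -> le0 t (R X Y).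
  by move=> [X0 _] Y0; apply/Dle0E/tens_le0 => //; apply/Dle0E.
have L_ge0 X Y : heart t X -> Dge t 0 Y -> Dge t 0 (L X Y).
  by move=> [_ X1] Y1; apply: tens_ge0.
have R_ge0 X Y : heart t X -> Dge t 0 Y -> Dge t 0 (R X Y).
  by move=> [_ X1] Y1; apply: tens_ge0.
set U := tunit (mt_monoidal T).
have L_U X : heart t X -> heart t (L X U).
  have [g [gr rg]] := runit_iso (mt_monoidal T) X.
  by apply: (heart_iso (f := g)); exists (runit (mt_monoidal T) X).
have R_U X : heart t X -> heart t (R X U).
  have [g [gr rg]] := lunit_iso (mt_monoidal T) X.
  by apply: (heart_iso (f := g)); exists (lunit (mt_monoidal T) X).
have [p [e [r per]]] := trunc_ge0_distinguished t U.
have [v [g [h vgh]]] := H0_distinguished t U.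
have L_iso X : heart t X -> is_iso (fmap (L X) e) /\ is_iso (fmap (L X) v).
  move=> hX; exact: (exact_functor_H0_zigzag (F := L X) (shift_tensr_iso X)
    (@tensor_left_triangulated k T X) (fun Y => @L_le0 X Y hX)
    (fun Y => @L_ge0 X Y hX) per vgh (L_U X hX)).
have R_iso X : heart t X -> is_iso (fmap (R X) e) /\ is_iso (fmap (R X) v).
  move=> hX; exact: (exact_functor_H0_zigzag (F := R X)
    (fun Y => shift_tensl_iso Y X) (@tensor_right_triangulated k T X)
    (fun Y => @R_le0 X Y hX) (fun Y => @R_ge0 X Y hX) per vgh (R_U X hX)).
exists heart_closed.
have [M [tensM unitM]] := restrict_monoidal heart_closed (H0_heart t U)
  (fun X hX => proj1 (R_iso X hX)) (fun X hX => proj1 (L_iso X hX))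
  (fun X hX => proj2 (R_iso X hX)) (fun X hX => proj2 (L_iso X hX)).
exists M; split=> //; rewrite tensM => X; split=> X1 X2 X3 f f' ff'.
  exact: (exact_functor_short_exact (@tensor_left_triangulated k T (sval X))).
exact: (exact_functor_short_exact (@tensor_right_triangulated k T (sval X))).
Qed.
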